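(* Let $1\le M\le N$ and let $\beta\ge\lambda_1\ge\lambda_2\ge\cdots\ge\lambda_M\ge\alpha$ be ordered real random variables whose joint p.d.f. on the ordered region $\beta\ge x_1\ge\cdots\ge x_M\ge\alpha$ is $$f_{\boldsymbol\lambda}(\boldsymbol x)=K\,\det\boldsymbol\Phi(\boldsymbol x)\,\det\boldsymbol\Psi(\boldsymbol x)\prod_{i=1}^{M}\xi(x_i),$$ where $K$ is the normalizing constant, $\xi$ is a function, $\boldsymbol\Phi(\boldsymbol x)\in\mathbb C^{M\times M}$ has entries $\Phi_i(x_j)$, and $\boldsymbol\Psi(\boldsymbol x)\in\mathbb C^{N\times N}$ has entries $\Psi_i(x_j)$ for $j\le M$ and constants $\bar\Psi_{i,j}$ for $M<j\le N$. Then for each $1\le\ell\le M$ the p.d.f. of $\lambda_\ell$ is, for $\alpha\le x_\ell\le\beta$, $$f_{\lambda_\ell}(x_\ell)=c(\ell)\,K\,\mathcal T(\boldsymbol A),\qquad c(\ell)=\frac{1}{(\ell-1)!\,(M-\ell)!},$$ where the $N\times N\times N$ tensor $\boldsymbol A=\boldsymbol A(x_\ell)$ has elements $$a_{i,j,k}=\begin{cases}\displaystyle\int_{x_\ell}^{\beta}\varsigma_i(x)\Psi_j(x)\,dx & k<\ell\le M\\ \varsigma_i(x_\ell)\Psi_j(x_\ell)& k=\ell\le M\\ \displaystyle\int_\alpha^{x_\ell}\varsigma_i(x)\Psi_j(x)\,dx & \ell<k\le M\\ 0& k>M,\ i<k\\ \bar\Psi_{j,k}& k>M,\ i\ge k,\end{cases}\qquad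 \varsigma_i(x)=\begin{cases}\Phi_i(x)\xi(x)& i\le M\\ \xi(x)& i>M.\end{cases}$$
   Context: For a rank-3 tensor $\boldsymbol A=\{a_{i,j,k}\}_{i,j,k=1,\dots,N}$ the pseudo-determinant is $\mathcal T(\boldsymbol A)=\sum_{\boldsymbol\mu}\operatorname{sgn}(\boldsymbol\mu)\sum_{\boldsymbol\alpha}\operatorname{sgn}(\boldsymbol\alpha)\prod_{k=1}^N a_{\mu_k,\alpha_k,k}$, where both sums run over all permutations of $\{1,\dots,N\}$. The endpoints $\alpha<\beta$ may be infinite. The scalar functions $\Phi_i$ ($1\le i\le M$), $\Psi_i$ ($1\le i\le N$), $\xi$ and the constants $\bar\Psi_{i,j}$ are arbitrary, subject to the function $f_{\boldsymbol\lambda}(\boldsymbol x)=K\,\det\boldsymbol\Phi(\boldsymbol x)\,\det\boldsymbol\Psi(\boldsymbol x)\prod_{i=1}^{M}\xi(x_i)$ being a p.d.f. on the ordered region $\beta\ge x_1\ge\cdots\ge x_M\ge\alpha$ and to the integrals appearing being well defined (absolutely convergent). *)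

(* Defs.v *)
From HB Require Import structures.
From mathcomp Require Import all_boot all_order all_algebra all_fingroup.
From mathcomp Require Import all_classical all_reals all_analysis.
From mathcomp Require Import complex.

Set Implicit Arguments.
Unset Strict Implicit.
Unset Printing Implicit Defensive.

Import Order.TTheory GRing.Theory Num.Theory.
Import numFieldNormedType.Exports.

Local Open Scope classical_set_scope.
Local Open Scope ring_scope.
Local Open Scope complex_scope.

Definition tuple_cons {R : realType} n (p : R * n.-tuple R) : n.+1.-tuple R :=
  [tuple of p.1 :: p.2].

(* n-dimensional Lebesgue measure, on n-tuples of reals. *)
Fixpoint lebesgue_measure_tuple {R : realType} n :
    set (n.-tuple R) -> \bar R :=
  match n return set (n.-tuple R) -> \bar R with
  | 0%N => \d_([tuple] : 0.-tuple R)
  | n'.+1 => pushforward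
      (@lebesgue_measure R \x @lebesgue_measure_tuple R n')%E (@tuple_cons R n')
  end.

Arguments lebesgue_measure_tuple : clear implicits.

Section tuple_cons_measure.
Context {R : realType} (n : nat).

Lemma measurable_tuple_cons :
  measurable_fun [set: measurableTypeR R * n.-tuple R] (@tuple_cons R n).
Proof. exact: (@measurable_cons _ _ _ (measurableTypeR R)). Qed.

Let tuple_uncons (t : n.+1.-tuple R) : measurableTypeR R * n.-tuple R :=
  (thead t, [tuple of behead t]).

Let measurable_tuple_uncons : measurable_fun [set: n.+1.-tuple R] tuple_uncons.
Proof.
apply/measurable_fun_pair => /=; last exact: measurable_behead.
exact: measurable_tnth.
Qed.

Variable m : {sigma_finite_measure set (n.-tuple R) -> \bar R}.

Let pm := ((@lebesgue_measure R \x m)%E : {measure set _ -> \bar R}).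

Let mu : {measure set (n.+1.-tuple R) -> \bar R} :=
  measure_function_pushforward__canonical__measure_function_Measure
    pm measurable_tuple_cons.

Let sigma_finite_mu : sigma_finite setT mu.
Proof.
have /sigma_finiteP[F [TF ndF Foo]] := sigma_finiteT (@lebesgue_measure R).
have /sigma_finiteP[G [TG ndG Goo]] := sigma_finiteT m.
exists (fun k => tuple_uncons @^-1` (F k `*` G k)).
  rewrite -preimage_bigcup -[LHS](preimage_setT tuple_uncons); congr preimage.
  rewrite -setXTT TF TG predeqE => -[x y]; split.
    move=> [/= [p _ Fpx] [k _ Gky]]; exists (maxn p k) => //; split.
    - by move: x Fpx; exact/subsetPset/ndF/leq_maxl.
    - by move: y Gky; exact/subsetPset/ndG/leq_maxr.
  by move=> [p _ []/= ? ?]; split; exists p.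
move=> k; have [? ?] := Foo k; have [? ?] := Goo k; split.
  rewrite -[X in measurable X]setTI.
  by apply: measurable_tuple_uncons => //; exact: measurableX.
rewrite /mu/= /pushforward -comp_preimage.
rewrite (_ : tuple_uncons \o _ = id); last first.
  apply/funext => -[x t] /=.
  by rewrite /tuple_uncons theadE; congr pair; exact/val_inj.
rewrite preimage_id.
by rewrite product_measure1E// lte_mul_pinfty// ge0_fin_numE.
Qed.

Lemma tuple_cons_measureP :
  exists m' : {sigma_finite_measure set (n.+1.-tuple R) -> \bar R},
    m' = pushforward (@lebesgue_measure R \x m)%E (@tuple_cons R n)
      :> (set (n.+1.-tuple R) -> \bar R).
Proof.
pose H := Measure_isSigmaFinite.Build _ _ _ mu sigma_finite_mu.
pose mu' : {sigma_finite_measure set (n.+1.-tuple R) -> \bar R} :=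
  HB.pack (mu : set _ -> \bar R) (Measure.class mu) H.
by exists mu'.
Qed.

End tuple_cons_measure.

Section lebesgue_measure_tuple_instance.
Context {R : realType} (n : nat).
Notation mu := (lebesgue_measure_tuple R n).

Let lebesgue_measure_tupleP :
  exists m : {sigma_finite_measure set (n.-tuple R) -> \bar R},
    m = mu :> (set (n.-tuple R) -> \bar R).
Proof.
elim: n => [|k [m mE]]; first by exists (\d_([tuple] : 0.-tuple R)).
by have [m' m'E] := tuple_cons_measureP m; exists m'; rewrite m'E mE.
Qed.

Let mu0 : mu set0 = 0%E.
Proof. by have [m <-] := lebesgue_measure_tupleP; exact: measure0. Qed.

Let mu_ge0 A : (0 <= mu A)%E.
Proof. by have [m <-] := lebesgue_measure_tupleP; exact: measure_ge0. Qed.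

Let mu_sigma_additive : semi_sigma_additive mu.
Proof.
by have [m <-] := lebesgue_measure_tupleP; exact: measure_semi_sigma_additive.
Qed.

HB.instance Definition _ :=
  isMeasure.Build _ _ _ mu mu0 mu_ge0 mu_sigma_additive.

Let mu_sigma_finite : sigma_finite setT mu.
Proof. by have [m <-] := lebesgue_measure_tupleP; exact: sigma_finiteT. Qed.

HB.instance Definition _ := Measure_isSigmaFinite.Build _ _ _ mu mu_sigma_finite.

End lebesgue_measure_tuple_instance.

(* [f] is a probability density on [D], with respect to [mu], of the law [nu]:
   nonnegativity is in the order of R[i], so it says that [f] is real on [D].
   When [nu setT = 1], the case [S = setT] is the normalization. *)
Definition is_pdf_on d (T : measurableType d) (R : realType)
    (mu : {measure set T -> \bar R}) (D : set T) (f : T -> R[i])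
    (nu : set T -> \bar R) : Prop :=
  [/\ measurable_fun D (fun x => complex.Re (f x)),
      (forall x, D x -> 0 <= f x) &
      forall S, measurable S ->
        nu S = (\int[mu]_(x in S `&` D) (complex.Re (f x))%:E)%E].

Section complex_integral.
Context {R : realType}.
Notation leb := (@lebesgue_measure R).

Definition Cintegrable (D : set R) (f : R -> R[i]) : Prop :=
  leb.-integrable D (fun x => (complex.Re (f x))%:E) /\
  leb.-integrable D (fun x => (complex.Im (f x))%:E).

Definition Cintegral (D : set R) (f : R -> R[i]) : R[i] :=
  (\int[leb]_(x in D) complex.Re (f x)) +i* (\int[leb]_(x in D) complex.Im (f x)).

End complex_integral.

Definition pseudo_det (C : comPzRingType) (N : nat)
    (A : 'I_N -> 'I_N -> 'I_N -> C) : C :=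
  \sum_(mu : 'S_N) (-1) ^+ mu *
    \sum_(al : 'S_N) (-1) ^+ al * \prod_(k < N) A (mu k) (al k) k.

Section ordered_density.
Context {R : realType}.
Variables (al be : \bar R) (M N : nat).

Definition segment : set R := [set x | (al <= x%:E <= be)%E].

(* be >= x_1 >= ... >= x_M >= al *)
Definition ordered_region : set (M.-tuple R) :=
  [set x | (forall i, segment (tnth x i)) /\
           (forall i j : 'I_M, (i <= j)%N -> tnth x j <= tnth x i)].

Variables (Phi : 'I_M -> R -> R[i]) (Psi : 'I_N -> R -> R[i]).
Variables (Psibar : 'I_N -> 'I_N -> R[i]) (xi : R -> R[i]) (K : R[i]).

Definition Phi_mx (x : M.-tuple R) : 'M[R[i]]_M :=
  \matrix_(i < M, j < M) Phi i (tnth x j).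

Definition Psi_mx (x : M.-tuple R) : 'M[R[i]]_N :=
  \matrix_(i < N, j < N)
    if insub (val j) is Some j' then Psi i (tnth x j') else Psibar i j.

Definition joint_density (x : M.-tuple R) : R[i] :=
  K * \det (Phi_mx x) * \det (Psi_mx x) * \prod_(i < M) xi (tnth x i).

Definition varsigma (i : 'I_N) (x : R) : R[i] :=
  if insub (val i) is Some i' then Phi i' x * xi x else xi x.

Definition below (x : R) : set R := [set y | (al <= y%:E)%E /\ y <= x].
Definition above (x : R) : set R := [set y | x <= y /\ (y%:E <= be)%E].

(* Indices start at 0, so that "k > M" reads [M <= k]. *)
Definition marginal_tensor (l : 'I_M) (x : R) (i j k : 'I_N) : R[i] :=
  if (k < l)%N then Cintegral (above x) (fun y => varsigma i y * Psi j y)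
  else if val k == val l then varsigma i x * Psi j x
  else if (k < M)%N then Cintegral (below x) (fun y => varsigma i y * Psi j y)
  else if (i < k)%N then 0
  else Psibar j k.

Definition marginal_tensor_integrable (l : 'I_M) : Prop :=
  forall x, segment x -> forall i j k : 'I_N,
    ((k < l)%N -> Cintegrable (above x) (fun y => varsigma i y * Psi j y)) /\
    ((l < k < M)%N -> Cintegrable (below x) (fun y => varsigma i y * Psi j y)).

(* Starting at 0, (l - 1)! (M - l)! becomes l! (M - 1 - l)!. *)
Definition marginal_const (l : 'I_M) : R[i] :=
  ((l`! * (M - l.+1)`!)%N%:R)^-1.

End ordered_density.

Arguments ordered_region {R} al be {M} _.

(* Main.v *)
Require Import Defs.
From HB Require Import structures.
From mathcomp Require Import all_boot all_order all_algebra all_fingroup.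
From mathcomp Require Import all_classical all_reals all_analysis.
From mathcomp Require Import complex.
From mathcomp Require Import measurable_realfun ring.

Set Implicit Arguments.
Unset Strict Implicit.
Unset Printing Implicit Defensive.

Import Order.TTheory GRing.Theory Num.Theory.
Import numFieldNormedType.Exports.

Local Open Scope classical_set_scope.
Local Open Scope ring_scope.
Local Open Scope complex_scope.

(** Write [rho_(i,j) x] for the product of [varsigma i x] and [Psi j x].

    The joint density is a pseudo-determinant.  When a tensor factors as
    [B i k * D j k], the double alternating sum factors too, and its
    pseudo-determinant is the product of the determinants of [B] and [D]
    ([pseudo_det_mul]).  At a point [t], the tensor with entries
    [rho_(i,j) (t_k)] for [k < M], and [0] or [Psibar j k] for [k >= M], is of
    that form: [D] is the matrix of the [Psi], and [B] is block triangular, its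
    upper left block being the matrix of the [Phi] with its columns scaled by
    [xi], and its lower right block being unitriangular.  Hence the density is
    [K] times the pseudo-determinant of that tensor ([joint_densityE]).  Slice
    [k < M] of the tensor depends on the coordinate [t_k] only, and permuting
    the slices of a tensor does not change its pseudo-determinant, as the sign
    of the permutation appears twice ([pseudo_det_perm]).  So the density
    formula defines a symmetric function of [t], which is nonnegative and
    measurable not only on the ordered region but wherever all coordinates lie
    in the segment.

    The event that [lambda_l] lies in [S] has probability the integral of the
    density over the ordered points [t] with [t_l] in [S].  Instead of ordering
    all coordinates, require only that those of index below [l] be at least
    [t_l] and those of index above [l] at most [t_l] ([pivot_region]).  By
    symmetry of the density and invariance of Lebesgue measure under
    permutations of the coordinates, the integral over this larger set is
    [l! (M - 1 - l)!] times the integral over the ordered one: almost every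
    point has distinct coordinates, and then exactly one permutation of each of
    the two blocks sorts it ([integral_symmetrize], [integral_pivot_region]).

    Once [t_l = x] is fixed, the larger set is a product of intervals, and the
    density is a signed sum of products of functions of one coordinate each.
    By Fubini, its integral over the other coordinates is obtained by replacing
    [rho_(i,j) (t_k)] by its integral over the [k]-th interval.  What comes out
    is [K] times the pseudo-determinant of the marginal tensor at [x]
    ([has_Cintegral_slice]).  Tonelli then gives the law of [lambda_l] and the
    measurability of its density.  The density is real and nonnegative at every
    [x], as it is the integral of a real nonnegative function. *)

(** * Pseudo-determinants and the joint density *)

Section pseudo_det.
Context {C : comNzRingType} (N : nat).

Lemma pseudo_det_mul (B D : 'M[C]_N) :
  pseudo_det (fun i j k => B i k * D j k) = \det B * \det D.
Proof.
rewrite -(det_tr B) -(det_tr D) /pseudo_det [in RHS]/determinant big_distrl /=.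
apply: eq_bigr => s _; rewrite -mulrA; congr (_ * _); rewrite mulr_sumr.
apply: eq_bigr => r _.
rewrite mulrCA -big_split /=; congr (_ * _).
by apply: eq_bigr => k _; rewrite !mxE.
Qed.

(** Reindexing the product over [k] multiplies both summation permutations by
    [s], so that the sign of [s] enters twice and cancels. *)
Lemma pseudo_det_perm (A : 'I_N -> 'I_N -> 'I_N -> C) (s : 'S_N) :
  pseudo_det (fun i j k => A i j (s k)) = pseudo_det A.
Proof.
have sgM (u : 'S_N) : (-1) ^+ (s * u)%g = (-1) ^+ s * (-1) ^+ u :> C.
  by rewrite odd_permM signr_addb.
rewrite /pseudo_det [LHS](reindex_inj (mulgI s))%g /=.
apply: eq_bigr => u _; rewrite [X in _ * X](reindex_inj (mulgI s))%g /=.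
rewrite !mulr_sumr; apply: eq_bigr => r _.
rewrite !sgM !mulrA; congr (_ * _).
  by rewrite -mulrA mulrACA -expr2 sqrr_sign mul1r.
rewrite [RHS](reindex_inj (@perm_inj _ s)) /=; apply: eq_bigr => k _.
by rewrite !permM.
Qed.

Lemma pseudo_det_scale (e : 'I_N -> C) (A : 'I_N -> 'I_N -> 'I_N -> C) :
  pseudo_det (fun i j k => e k * A i j k) = (\prod_k e k) * pseudo_det A.
Proof.
rewrite /pseudo_det mulr_sumr; apply: eq_bigr => s _.
rewrite mulrCA; congr (_ * _); rewrite mulr_sumr; apply: eq_bigr => r _.
by rewrite mulrCA big_split.
Qed.

End pseudo_det.

Definition permute_tuple T n (s : 'S_n) (t : n.-tuple T) : n.-tuple T :=
  [tuple tnth t (s i) | i < n].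

Section point_tensor.
Context {R : realType} (M N : nat).
Context (Phi : 'I_M -> R -> R[i]) (Psi : 'I_N -> R -> R[i]).
Context (Psibar : 'I_N -> 'I_N -> R[i]) (xi : R -> R[i]).

(** The marginal tensor before integration: every slice [k < M] is evaluated at
    the coordinate [t_k].  The zeros in the rows [i < k] of the other slices
    reduce a determinant of size [N] to that of the [Phi], of size [M]. *)
Definition point_tensor (t : M.-tuple R) (i j k : 'I_N) : R[i] :=
  if insub (val k) is Some k'
  then varsigma Phi xi i (tnth t k') * Psi j (tnth t k')
  else if (i < k)%N then 0 else Psibar j k.

End point_tensor.

(** The tensor factors into two matrices; the one that carries the [Phi] is
    block triangular. *)
Lemma joint_densityE (R : realType) (M N : nat) (hMN : (M <= N)%N)
    (Phi : 'I_M -> R -> R[i]) (Psi : 'I_N -> R -> R[i])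
    (Psibar : 'I_N -> 'I_N -> R[i]) (xi : R -> R[i]) (K : R[i])
    (t : M.-tuple R) :
  joint_density Phi Psi Psibar xi K t =
  K * pseudo_det (point_tensor Phi Psi Psibar xi t).
Proof.
move: Psi Psibar; rewrite -(subnKC hMN); move: (N - M)%N => p Psi Psibar.
pose Phit : 'M[R[i]]_(M + p) := block_mx
  (Phi_mx Phi t *m diag_mx (\row_j xi (tnth t j))) 0
  (\matrix_(i < p, j < M) varsigma Phi xi (rshift M i) (tnth t j))
  (\matrix_(i < p, j < p) (j <= i)%N%:R).
have -> : pseudo_det (point_tensor Phi Psi Psibar xi t) =
    pseudo_det (fun i j k => Phit i k * Psi_mx Psi Psibar t j k).
  apply: eq_bigr => s _; congr (_ * _); apply: eq_bigr => r _; congr (_ * _).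
  apply: eq_bigr => k _; rewrite [Psi_mx _ _ _ _ _]mxE /point_tensor.
  case: (split_ordP k) => k' -> /=.
    rewrite valK.
    congr (_ * _); rewrite /varsigma.
    case: (split_ordP (s (lshift p k'))) => i -> /=.
      by rewrite valK block_mxEul mul_mx_diag !mxE.
    by rewrite block_mxEdl mxE /varsigma.
  rewrite insubF; last by rewrite ltnNge leq_addr.
  case: (split_ordP (s (rshift M k'))) => i -> /=.
    by rewrite block_mxEur !mxE mul0r ltn_addr.
  rewrite block_mxEdr !mxE ltn_add2l ltnNge.
  by case: (k' <= i)%N; rewrite ?mul1r ?mul0r.
rewrite pseudo_det_mul det_lblock det_mulmx det_diag /joint_density.
have -> : \det (\matrix_(i < p, j < p) (j <= i)%N%:R) = 1 :> R[i].
  rewrite det_trig ?big1// => [i _|]; first by rewrite mxE leqnn.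
  by apply/is_trig_mxP => i j ij; rewrite mxE leqNgt ij.
rewrite mulr1 -!mulrA; congr (_ * (_ * _)); rewrite mulrC; congr (_ * _).
by apply: eq_bigr => i _; rewrite mxE.
Qed.

(** A permutation of the [M] coordinates extends by the identity to the [N]
    slices of the tensor, which only moves slices around. *)
Lemma joint_density_permute (R : realType) (M N : nat) (hMN : (M <= N)%N)
    (Phi : 'I_M -> R -> R[i]) (Psi : 'I_N -> R -> R[i])
    (Psibar : 'I_N -> 'I_N -> R[i]) (xi : R -> R[i]) (K : R[i])
    (s : 'S_M) (t : M.-tuple R) :
  joint_density Phi Psi Psibar xi K (permute_tuple s t) =
  joint_density Phi Psi Psibar xi K t.
Proof.
rewrite !joint_densityE//; congr (_ * _).
pose f (k : 'I_N) : 'I_N :=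
  if insub (val k) is Some k' then widen_ord hMN (s k') else k.
have f_inj : injective f.
  move=> i j; rewrite /f.
  case: insubP => [i' _ vi|iM]; case: insubP => [j' _ vj|jM].
  - move=> /(congr1 val)/= /val_inj/perm_inj ij.
    by apply/val_inj; rewrite -vi -vj ij.
  - by move=> /(congr1 val)/= ij; move: jM; rewrite /= -ij ltn_ord.
  - by move=> /(congr1 val)/= ij; move: iM; rewrite /= ij ltn_ord.
  - by [].
pose sN := perm f_inj.
rewrite -(pseudo_det_perm (point_tensor Phi Psi Psibar xi t) sN).
congr pseudo_det; apply/funext => i; apply/funext => j; apply/funext => k.
rewrite /point_tensor permE /f.
case: insubP => [k' _ vk|kM]; last by rewrite insubN.
by rewrite /= valK tnth_mktuple.
Qed.

(** * Sorting some of the coordinates *)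

Section sorting.
Context {R : realType} (n : nat).
Implicit Types (A : {set 'I_n}) (s : 'S_n) (t : n.-tuple R).

Definition decreasing_on A : set (n.-tuple R) :=
  [set t | {in A &, forall i j : 'I_n, (i <= j)%N -> tnth t j <= tnth t i}].

(** Rearrangement: among the permutations supported in [A], take one that
    minimizes the sum of the [i * t_(s i)].  If two of the rearranged
    coordinates in [A] were out of order, exchanging them would lower the
    sum. *)
Lemma exists_sorting A t :
  exists2 s, perm_on A s & decreasing_on A (permute_tuple s t).
Proof.
pose F s := \sum_(i < n) i%:R * tnth t (s i).
have [s sA smin] :=
  @arg_minP _ _ _ (1 : 'S_n)%g (perm_on A) F (perm_on1 A).
exists s => // i j iA jA; rewrite leq_eqVlt => /predU1P[/val_inj->//|ij].
rewrite !tnth_mktuple leNgt; apply/negP => lt_ij.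
have tA : perm_on A (tperm i j).
  apply/fintype.subsetP => k; rewrite inE.
  by case: tpermP => [->|->|_ _]; rewrite ?eqxx.
have := smin _ (perm_onM tA sA); rewrite leNgt => /negP; apply.
have ji : j != i by rewrite gt_eqF.
(* The two sums differ only in the terms of index [i] and [j]. *)
rewrite /F [ltLHS](bigD1 i)// [ltRHS](bigD1 i)//= (bigD1 j)//= [ltRHS](addrC).
rewrite [in ltRHS](bigD1 j)//= [ltRHS]addrC !permM tpermL tpermR addrA.
rewrite [ltRHS]addrA; under eq_bigr => k /andP[ki kj].
  rewrite permM tpermD 1?eq_sym//; over.
rewrite ltrD2r -subr_gt0.
have -> : i%:R * tnth t (s i) + j%:R * tnth t (s j) -
    (i%:R * tnth t (s j) + j%:R * tnth t (s i)) =
    (j%:R - i%:R) * (tnth t (s j) - tnth t (s i)) :> R by ring.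
by rewrite mulr_gt0// subr_gt0// ltr_nat.
Qed.

(** The number of coordinates in [A] that exceed [t_k] determines the place of
    [k] in the sorted order. *)
Lemma sorting_unique A t s1 s2 : injective (tnth t) ->
  perm_on A s1 -> perm_on A s2 ->
  decreasing_on A (permute_tuple s1 t) -> decreasing_on A (permute_tuple s2 t) ->
  s1 = s2.
Proof.
move=> t_inj s1A s2A dec1 dec2.
pose earlier (i : 'I_n) : {set 'I_n} := [set j in A | (j < i)%N]%SET.
pose larger (k : 'I_n) : {set 'I_n} := [set j in A | tnth t k < tnth t j]%SET.
have largerE s i : perm_on A s -> decreasing_on A (permute_tuple s t) ->
    i \in A -> #|larger (s i)| = #|earlier i|.
  move=> sA dec iA; rewrite -[RHS](card_imset _ (@perm_inj _ s)).
  apply: eq_card => k; apply/idP/idP => [|/imsetP[j]].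
    rewrite inE => /andP[kA lt_k]; apply/imsetP.
    exists (s^-1%g k); last by rewrite permKV.
    rewrite inE (perm_closed _ (perm_onV sA)) kA /= ltnNge; apply/negP => le_ik.
    have := dec _ _ iA _ le_ik.
    rewrite (perm_closed _ (perm_onV sA)) => /(_ kA).
    by rewrite !tnth_mktuple permKV leNgt lt_k.
  rewrite !inE => /andP[jA ji] ->; rewrite (perm_closed _ sA) jA /=.
  have := dec _ _ jA iA (ltnW ji); rewrite !tnth_mktuple le_eqVlt.
  by case/predU1P => // /t_inj/perm_inj ij; rewrite ij ltnn in ji.
have earlier_mono (i j : 'I_n) :
    i \in A -> (i < j)%N -> (#|earlier i| < #|earlier j|)%N.
  move=> iA ij; apply/proper_card/properP; split.
    by apply/fintype.subsetP => k; rewrite !inE => /andP[-> /ltn_trans]; exact.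
  by exists i; rewrite !inE iA//= ltnn.
apply/permP => i; have [iA|iA] := boolP (i \in A); last first.
  by rewrite !(out_perm _ iA).
pose j := s2^-1%g (s1 i).
have jA : j \in A by rewrite (perm_closed _ (perm_onV s2A)) (perm_closed _ s1A).
have s2j : s2 j = s1 i by rewrite permKV.
have : #|earlier i| = #|earlier j|.
  by rewrite -(largerE s1)// -(largerE s2)// s2j.
case: (ltngtP i j) => [/(earlier_mono _ _ iA)|/(earlier_mono _ _ jA)|ij _].
- by move=> /[swap] ->; rewrite ltnn.
- by move=> /[swap] ->; rewrite ltnn.
- by rewrite -s2j; congr (s2 _); apply: val_inj.
Qed.

(** Existence and uniqueness of the sorting permutation, in the form in which
    they are integrated. *)
Lemma sum_indic_sorting A t : injective (tnth t) ->
  \sum_(s : 'S_n | perm_on A s) \1_(decreasing_on A) (permute_tuple s t) = 1 :> R.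
Proof.
move=> t_inj; have [s sA dec] := exists_sorting A t.
rewrite (bigD1 s)//= indicE mem_set// big1 ?addr0// => s' /andP[s'A s's].
rewrite indicE memNset// => dec'; move/eqP: s's; apply.
exact: (sorting_unique t_inj s'A sA).
Qed.

End sorting.

(** * Lebesgue measure on tuples *)

Definition box {T : Type} n (A : 'I_n -> set T) : set (n.-tuple T) :=
  [set t | forall i, A i (tnth t i)].

Section tuple_measure.
Context {R : realType}.
Notation leb := (@lebesgue_measure R).
Notation leb_tuple := (lebesgue_measure_tuple R).

Lemma measurable_box n (A : 'I_n -> set R) :
  (forall i, measurable (A i)) -> measurable (box A).
Proof.
move=> mA; have -> : box A = \bigcap_i (@tnth n R ^~ i @^-1` A i).
  by apply/seteqP; split=> [t At i _ //|t At i]; exact: At.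
apply: fin_bigcap_measurable => // i _.
by rewrite -[X in measurable X]setTI; exact: measurable_tnth.
Qed.

Lemma tuple_cons_box n (A : 'I_n.+1 -> set R) :
  @tuple_cons R n @^-1` box A = A ord0 `*` box (A \o lift ord0).
Proof.
apply/seteqP; split=> [[x t] At|[x t] [/= A0 At] i].
  by split=> [|i]; [exact: (At ord0)|have := At (lift ord0 i); rewrite tnthS].
by case: (unliftP ord0 i) => [j|] ->; rewrite ?tnthS ?tnth0//; exact: At.
Qed.

Lemma lebesgue_measure_box n (A : 'I_n -> set R) :
  (forall i, measurable (A i)) ->
  leb_tuple n (box A) = (\prod_(i < n) leb (A i))%E.
Proof.
elim: n A => [|n IHn] A mA.
  by rewrite big_ord0 /= diracE mem_set// => -[].
rewrite /= /pushforward tuple_cons_box product_measure1E; last 2 first.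
- exact: mA.
- by apply: measurable_box => i; exact: mA.
by rewrite big_ord_recl; congr (_ * _)%E; apply: IHn => i; exact: mA.
Qed.

Lemma measurable_permute_tuple n (s : 'S_n) :
  measurable_fun setT (@permute_tuple R n s).
Proof.
apply/measurable_fun_tnthP => i.
rewrite (_ : _ \o _ = @tnth n R ^~ (s i)); first exact: measurable_tnth.
by apply/funext => t /=; rewrite tnth_mktuple.
Qed.

(** Boxes generate the sigma-algebra of tuples and are stable under
    intersection, and the boxes over an exhaustion of the line by sets of finite
    measure cover the space. *)
Lemma lebesgue_measure_tuple_unique n (m : {measure set (n.-tuple R) -> \bar R}) :
  (forall A : 'I_n -> set R, (forall i, measurable (A i)) ->
    m (box A) = (\prod_(i < n) leb (A i))%E) ->
  forall A, measurable A -> leb_tuple n A = m A.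
Proof.
move=> mE A mA.
have /sigma_finiteP[F [TF ndF Foo]] := sigma_finiteT leb.
pose G := [set B | exists2 A : 'I_n -> set R,
  (forall i, measurable (A i)) & B = box A].
apply: (measure_unique G (fun k => box (fun=> F k))) => //.
- apply/seteqP; split=> [B|B].
    apply: smallest_sub; first exact: smallest_sigma_algebra.
    move=> C; rewrite -bigcup_seq => -[/= i _ [D mD <-]].
    apply: sub_sigma_algebra.
    (* A preimage under one coordinate is a box with all other sides full. *)
    exists (fun j => if j == i then D else setT).
      by move=> j; case: ifP.
    apply/seteqP; split=> [t [_ Dt] j|t /(_ i)]; last by rewrite eqxx.
    by case: eqP => // ->.
  apply: smallest_sub; first exact: sigma_algebra_measurable.
  by move=> _ [C mC ->]; exact: measurable_box.
- move=> _ _ [B mB ->] [C mC ->]; exists (fun i => B i `&` C i).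
    by move=> i; exact: measurableI.
  by apply/seteqP; split=> [t [Bt Ct] i|t BCt]; [split|split=> i; case: (BCt i)].
- by move=> k; exists (fun=> F k) => // _; case: (Foo k).
- apply/seteqP; split=> // t _.
  have /choice[k kF] : forall i, exists k, F k (tnth t i).
    move=> i; have : (\bigcup_k F k) (tnth t i) by rewrite -TF.
    by case=> k _; exists k.
  exists (\max_i k i)%N => // i.
  by move: (kF i); exact/subsetPset/ndF/leq_bigmax.
- by move=> _ [B mB ->]; rewrite mE//; exact: lebesgue_measure_box.
- move=> k; rewrite [ltLHS](_ : _ = \prod_(i < n) leb (F k))%E; last first.
    by apply: lebesgue_measure_box => _; case: (Foo k).
  rewrite -ge0_fin_numE ?prode_ge0//.
  by apply: prode_fin_num => i _; rewrite ge0_fin_numE//; case: (Foo k).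
Qed.

(** Permuting the coordinates maps a box to a box with permuted sides, of the
    same measure. *)
Lemma lebesgue_measure_permute n (s : 'S_n) (A : set (n.-tuple R)) :
  measurable A -> leb_tuple n (permute_tuple s @^-1` A) = leb_tuple n A.
Proof.
pose m := measure_function_pushforward__canonical__measure_function_Measure
    (leb_tuple n : {measure set _ -> \bar R}) (measurable_permute_tuple s).
move=> mA; apply/esym/(@lebesgue_measure_tuple_unique n m) => // B mB.
rewrite /m /= /pushforward (_ : _ @^-1` _ = box (B \o s^-1%g)).
  rewrite lebesgue_measure_box => [|i]; last exact: mB.
  by rewrite (reindex_inj (@perm_inj _ s)); apply: eq_bigr => i _ /=; rewrite permK.
apply/seteqP; split=> t Bt i.
  by have := Bt (s^-1%g i); rewrite tnth_mktuple permKV.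
by rewrite tnth_mktuple; have := Bt (s i); rewrite /= permK.
Qed.

Lemma ge0_integral_permute n (s : 'S_n) (h : n.-tuple R -> \bar R) :
  measurable_fun setT h -> (forall t, 0 <= h t)%E ->
  (\int[leb_tuple n]_t h (permute_tuple s t) = \int[leb_tuple n]_t h t)%E.
Proof.
move=> mh h0; have ms := measurable_permute_tuple s.
rewrite -[LHS](@ge0_integral_pushforward _ _ _ _ _ _ ms _ setT)//.
by apply: eq_measure_integral => A mA _; exact: lebesgue_measure_permute.
Qed.

Lemma ge0_integral_tuple_cons n (h : n.+1.-tuple R -> \bar R) :
  measurable_fun setT h -> (forall t, 0 <= h t)%E ->
  (\int[leb_tuple n.+1]_t h t =
   \int[leb]_x \int[leb_tuple n]_t h (tuple_cons (x, t)))%E.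
Proof.
move=> mh h0.
have mc := @measurable_tuple_cons R n.
have mhc : measurable_fun setT (h \o @tuple_cons R n) by exact: measurableT_comp.
have E := @fubini_tonelli1 _ _ _ _ R leb (leb_tuple n) (h \o @tuple_cons R n)
  mhc (fun=> h0 _).
rewrite -[RHS]/(\int[leb]_x fubini_F (leb_tuple n) (h \o @tuple_cons R n) x)%E.
rewrite -[RHS]E.
by rewrite -[RHS](@ge0_integral_pushforward _ _ _ _ _ _ mc _ setT).
Qed.

Lemma measurable_tuple_diagonal n (i j : 'I_n) :
  measurable [set t : n.-tuple R | tnth t i = tnth t j].
Proof.
have mij : measurable_fun setT (fun t : n.-tuple R => tnth t i - tnth t j).
  by apply: measurable_funB; exact: measurable_tnth.
have := mij measurableT _ (measurable_set1 0); rewrite setTI.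
congr measurable; apply/seteqP; split=> t /=; last by move=> ->; rewrite subrr.
by move/subr0_eq.
Qed.

(** If one of the two coordinates is the head, then for each value [x] of the
    head the section is a box with a side reduced to a point.  Otherwise the
    sections are diagonals in one dimension less. *)
Lemma tuple_diagonal_null n (i j : 'I_n) : i != j ->
  leb_tuple n [set t | tnth t i = tnth t j] = 0%E.
Proof.
elim: n i j => [[]//|n IHn].
have head_null (k : 'I_n) (A : set (R * n.-tuple R)) :
    (forall x t, A (x, t) <-> x = tnth t k) ->
    (leb \x leb_tuple n)%E A = 0%E.
  move=> AE; apply: integral0_eq => x _ /=.
  rewrite (_ : xsection A x = box (fun i => if i == k then [set x] else setT)).
    rewrite [LHS]lebesgue_measure_box => [|i]; last by case: ifP.
    by rewrite (bigD1 k)//= eqxx lebesgue_measure_set1 mul0e.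
  apply/seteqP; split=> t; rewrite /xsection/= inE AE.
    by move=> -> i; case: eqP => // ->.
  by move=> /(_ k); rewrite eqxx.
move=> i j; case: (unliftP ord0 i) => [i'|] ->; case: (unliftP ord0 j) => [j'|] ->.
- rewrite (inj_eq lift_inj) => ij; apply: integral0_eq => x _ /=.
  rewrite -[RHS](IHn _ _ ij); congr (leb_tuple n _).
  by apply/seteqP; split=> t; rewrite /xsection/= inE/= !tnthS.
- move=> _; apply: (head_null i') => x t.
  by rewrite /= tnthS tnth0; split=> ->.
- move=> _; apply: (head_null j') => x t.
  by rewrite /= tnthS tnth0.
- by rewrite eqxx.
Qed.

Lemma ae_tuple_injective n :
  {ae leb_tuple n, forall t : n.-tuple R, injective (tnth t)}.
Proof.
have ij_neq (p : 'I_n * 'I_n) : {ae leb_tuple n, forall t : n.-tuple R,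
    p.1 != p.2 -> tnth t p.1 <> tnth t p.2}.
  have [p12|p12] := eqVneq p.1 p.2; first exact: aeW.
  exists [set t | tnth t p.1 = tnth t p.2]; split.
  - exact: measurable_tuple_diagonal.
  - exact: tuple_diagonal_null.
  - by move=> t /= tp; apply: contrapT => p_neq; apply: tp.
have : {ae leb_tuple n, forall t : n.-tuple R, forall p : 'I_n * 'I_n,
    p.1 != p.2 -> tnth t p.1 <> tnth t p.2} by exact: filter_forall.
apply: filterS => t t_neq i j tij.
by apply/eqP/negPn/negP => /(t_neq (i, j)).
Qed.

Lemma measurable_decreasing_on n (A : {set 'I_n}) :
  measurable (@decreasing_on R n A).
Proof.
pose D (p : 'I_n * 'I_n) : set (n.-tuple R) :=
  if [&& p.1 \in A, p.2 \in A & (p.1 <= p.2)%N]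
  then [set t | tnth t p.2 <= tnth t p.1] else setT.
rewrite (_ : decreasing_on A = \big[setI/setT]_(p : 'I_n * 'I_n) D p).
  apply: bigsetI_measurable => p _; rewrite /D; case: ifP => // _.
  rewrite -[X in measurable X]setTI.
  by apply: measurable_fun_le => //; exact: measurable_tnth.
rewrite -bigcap_seq; apply/seteqP; split=> [t dec [i j] _|t Dt i j iA jA ij].
  by rewrite /D /=; case: ifP => // /and3P[iA jA ij]; exact: dec.
by have := Dt (i, j) (mem_index_enum _); rewrite /D /= iA jA ij.
Qed.

(** Almost everywhere, [h] is the sum over the permutations [s] of [A] of [h]
    times the indicator that [s] sorts the point on [A].  By invariance of [h]
    and of the measure, all terms have the same integral. *)
Lemma integral_symmetrize n (A : {set 'I_n}) (h : n.-tuple R -> \bar R) :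
  measurable_fun setT h -> (forall t, 0 <= h t)%E ->
  (forall s t, perm_on A s -> h (permute_tuple s t) = h t) ->
  (\int[leb_tuple n]_t h t =
   (#|A| `!)%:R%:E *
     \int[leb_tuple n]_t (h t * (\1_(decreasing_on A) t)%:E))%E.
Proof.
move=> mh h0 hA.
have mdec := measurable_decreasing_on A.
pose g t := (h t * (\1_(decreasing_on A) t)%:E)%E.
have mg : measurable_fun setT g.
  by apply: emeasurable_funM => //; apply/measurable_EFinP.
have g0 t : (0 <= g t)%E by rewrite mule_ge0// lee_fin.
transitivity (\int[leb_tuple n]_t
    \sum_(s <- enum (perm_on A)) g (permute_tuple s t))%E.
  apply: ge0_ae_eq_integral => //.
  - apply: emeasurable_sum => s; apply: measurableT_comp => //.
    exact: measurable_permute_tuple.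
  - by move=> t _; apply: sume_ge0.
  - move: (ae_tuple_injective n); apply: filterS => t t_inj _.
    rewrite /g big_enum/= (eq_bigr (fun s =>
        h t * (\1_(decreasing_on A) (permute_tuple s t))%:E)%E).
      rewrite -ge0_sume_distrr => [|s _]; last by rewrite lee_fin.
      rewrite sumEFin (eq_bigl (perm_on A))//.
      by rewrite (sum_indic_sorting A t_inj) mule1.
    by move=> s sA; rewrite hA.
rewrite ge0_integral_sum//; last first.
  move=> s; apply: measurableT_comp => //.
  exact: measurable_permute_tuple.
under eq_bigr do rewrite ge0_integral_permute//.
by rewrite big_enum/= sumr_const card_perm mule_natl.
Qed.

End tuple_measure.

(** * Integrals of complex functions *)

Section has_integral.
Context {R : realType}.

(** Integrability and the value of the integral are kept together, since each
    closure property below carries both along. *)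
Definition has_integral d (T : measurableType d)
    (mu : {measure set T -> \bar R}) (f : T -> R) (a : R) : Prop :=
  mu.-integrable setT (EFin \o f) /\ (\int[mu]_x (f x)%:E = a%:E)%E.

Definition has_Cintegral d (T : measurableType d)
    (mu : {measure set T -> \bar R}) (f : T -> R[i]) (z : R[i]) : Prop :=
  has_integral mu (fun x => complex.Re (f x)) (complex.Re z) /\
  has_integral mu (fun x => complex.Im (f x)) (complex.Im z).

Section theory.
Context d (T : measurableType d) (mu : {measure set T -> \bar R}).

Lemma has_integralZ c f a :
  has_integral mu f a -> has_integral mu (fun x => c * f x) (c * a).
Proof.
move=> [intf fa]; split; first exact: (integrableZl measurableT c intf).
by under eq_integral do rewrite EFinM; rewrite integralZl// fa.
Qed.

Lemma has_integralD f g a b : has_integral mu f a -> has_integral mu g b ->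
  has_integral mu (fun x => f x + g x) (a + b).
Proof.
move=> [intf fa] [intg gb]; split.
  exact: (integrableD measurableT intf intg).
by under eq_integral do rewrite EFinD; rewrite integralD// fa gb.
Qed.

Lemma has_integralB f g a b : has_integral mu f a -> has_integral mu g b ->
  has_integral mu (fun x => f x - g x) (a - b).
Proof.
move=> fa /(has_integralZ (-1)); rewrite mulN1r => /(has_integralD fa).
by under eq_fun do rewrite mulN1r.
Qed.

Lemma has_integral_cst0 : has_integral mu (fun=> 0) 0.
Proof. by split; [exact: integrable0|exact: integral0]. Qed.

Lemma has_CintegralZ c f z :
  has_Cintegral mu f z -> has_Cintegral mu (fun x => c * f x) (c * z).
Proof.
case: c z => [a b] [p q] [/= fp fq]; split => /=.
  rewrite (_ : (fun x => _) =
      fun x => a * complex.Re (f x) - b * complex.Im (f x)).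
    by apply: has_integralB; exact: has_integralZ.
  by apply/funext => x; case: (f x).
rewrite (_ : (fun x => _) =
    fun x => a * complex.Im (f x) + b * complex.Re (f x)).
  by apply: has_integralD; exact: has_integralZ.
by apply/funext => x; case: (f x).
Qed.

Lemma has_CintegralD f g z w : has_Cintegral mu f z -> has_Cintegral mu g w ->
  has_Cintegral mu (fun x => f x + g x) (z + w).
Proof.
case: z w => [p q] [r s] [/= fp fq] [/= gr gs]; split => /=.
  rewrite (_ : (fun x => _) = fun x => complex.Re (f x) + complex.Re (g x)).
    exact: has_integralD.
  by apply/funext => x; case: (f x); case: (g x).
rewrite (_ : (fun x => _) = fun x => complex.Im (f x) + complex.Im (g x)).
  exact: has_integralD.
by apply/funext => x; case: (f x); case: (g x).
Qed.

Lemma has_Cintegral_sum (I : Type) (r : seq I) (f : I -> T -> R[i]) (z : I -> R[i]) :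
  (forall i, has_Cintegral mu (f i) (z i)) ->
  has_Cintegral mu (fun x => \sum_(i <- r) f i x) (\sum_(i <- r) z i).
Proof.
move=> fz; elim: r => [|i r IHr].
  rewrite (_ : (fun x => _) = fun=> 0); last by apply/funext => x; rewrite big_nil.
  by rewrite big_nil; split; exact: has_integral_cst0.
rewrite big_cons (_ : (fun x => _) = fun x => f i x + \sum_(j <- r) f j x).
  exact: has_CintegralD.
by apply/funext => x; rewrite big_cons.
Qed.

End theory.

Notation leb := (@lebesgue_measure R).
Notation leb_tuple := (lebesgue_measure_tuple R).

Lemma has_integral_cons n (f : R -> R) (g : n.-tuple R -> R) (a b : R) :
  has_integral leb f a -> has_integral (leb_tuple n) g b ->
  has_integral (leb_tuple n.+1)
    (fun t => f (tnth t ord0) * g [tuple of behead t]) (a * b).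
Proof.
move=> [intf fa] [intg gb].
pose h (p : R * n.-tuple R) : \bar R := (f p.1 * g p.2)%:E.
pose k (t : n.+1.-tuple R) : \bar R := (f (tnth t ord0) * g [tuple of behead t])%:E.
have mf : measurable_fun setT f by apply/measurable_EFinP; exact: measurable_int intf.
have mg : measurable_fun setT g by apply/measurable_EFinP; exact: measurable_int intg.
have mh : measurable_fun setT h.
  apply/measurable_EFinP; apply: measurable_funM.
    exact: (measurableT_comp mf).
  exact: (measurableT_comp mg).
have mk : measurable_fun setT k.
  apply/measurable_EFinP; apply: measurable_funM.
    by apply: (measurableT_comp mf); exact: measurable_tnth.
  by apply: (measurableT_comp mg); exact: measurable_behead.
have kE : k \o @tuple_cons R n = h.
  apply/funext => -[x t]; rewrite /k /h /= tnth0; congr (_ * g _)%:E.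
  exact: val_inj.
have mc := @measurable_tuple_cons R n.
have inth : (leb \x leb_tuple n)%E.-integrable setT h.
  apply/(@integrable12ltyP _ _ _ _ R leb (leb_tuple n) h mh).
  have hE x : (\int[leb_tuple n]_y `|h (x, y)| =
      `|(f x)%:E| * \int[leb_tuple n]_y `|(g y)%:E|)%E.
    rewrite -ge0_integralZl//=; last by apply/measurable_EFinP/measurableT_comp.
    by apply: eq_integral => y _; rewrite /h /= normrM.
  under eq_integral do rewrite hE.
  rewrite ge0_integralZr//=; last 2 first.
  - by apply/measurable_EFinP/measurableT_comp.
  - exact: integral_ge0.
  case/integrableP: intf => _ f_oo; case/integrableP: intg => _ g_oo.
  by rewrite lte_mul_pinfty ?integral_ge0// ge0_fin_numE ?integral_ge0.
split.
  have /integrableP[_ koo] : (pushforward (leb \x leb_tuple n)%E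
      (@tuple_cons R n)).-integrable setT k.
    by apply: integrable_pushforward => //; rewrite kE.
  by apply/integrableP; split.
transitivity (\int[leb \x leb_tuple n]_p h p)%E.
  have kint : (leb \x leb_tuple n)%E.-integrable
    (@tuple_cons R n @^-1` setT) (k \o @tuple_cons R n) by rewrite kE.
  by have := integral_pushforward mc mk kint measurableT; rewrite kE => <-.
rewrite -(@integral12_prod_meas1 _ _ _ _ R leb (leb_tuple n))//.
rewrite /fubini_F.
under eq_integral => x _.
  under eq_integral do rewrite /h /= EFinM.
  rewrite integralZl// gb.
  over.
by rewrite /= integralZr// fa.
Qed.

Lemma has_Cintegral_cons n (f : R -> R[i]) (g : n.-tuple R -> R[i]) (z w : R[i]) :
  has_Cintegral leb f z -> has_Cintegral (leb_tuple n) g w ->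
  has_Cintegral (leb_tuple n.+1)
    (fun t => f (tnth t ord0) * g [tuple of behead t]) (z * w).
Proof.
case: z w => [p q] [r s] [/= fp fq] [/= gr gs].
pose fst_snd (a : R -> R) (b : n.-tuple R -> R) (t : n.+1.-tuple R) :=
  a (tnth t ord0) * b [tuple of behead t].
split => /=.
  rewrite (_ : (fun t => _) = fun t : n.+1.-tuple R =>
      fst_snd (fun x => complex.Re (f x)) (fun x => complex.Re (g x)) t -
      fst_snd (fun x => complex.Im (f x)) (fun x => complex.Im (g x)) t).
    by apply: has_integralB; exact: has_integral_cons.
  by apply/funext => t; rewrite /fst_snd /=; case: (f _) (g _) => ? ? [].
rewrite (_ : (fun t => _) = fun t : n.+1.-tuple R =>
    fst_snd (fun x => complex.Re (f x)) (fun x => complex.Im (g x)) t +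
    fst_snd (fun x => complex.Im (f x)) (fun x => complex.Re (g x)) t).
  by apply: has_integralD; exact: has_integral_cons.
by apply/funext => t; rewrite /fst_snd /=; case: (f _) (g _) => ? ? [].
Qed.

Lemma has_Cintegral_prod n (f : 'I_n -> R -> R[i]) (z : 'I_n -> R[i]) :
  (forall i, has_Cintegral leb (f i) (z i)) ->
  has_Cintegral (leb_tuple n) (fun t => \prod_(i < n) f i (tnth t i))
    (\prod_(i < n) z i).
Proof.
elim: n f z => [|n IHn] f z fz.
  rewrite big_ord0 (_ : (fun t => _) = fun=> 1); last first.
    by apply/funext => t; rewrite big_ord0.
  split; last exact: has_integral_cst0.
  split.
    apply/integrableP; split; first exact: measurable_cst.
    by rewrite integral_cst//= diracT mule1 normr1 ltry.
  by rewrite integral_cst//= diracT mule1.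
pose g (u : n.-tuple R) := \prod_(i < n) f (lift ord0 i) (tnth u i).
rewrite big_ord_recl (_ : (fun t => _) = fun t : n.+1.-tuple R =>
    f ord0 (tnth t ord0) * g [tuple of behead t]).
  have gz := IHn _ _ (fun i => fz (lift ord0 i)).
  exact: (@has_Cintegral_cons _ _ g _ _ (fz ord0) gz).
apply/funext => t; rewrite big_ord_recl; congr (_ * _).
by apply: eq_bigr => i _; rewrite [in LHS](tuple_eta t) tnthS.
Qed.

(** The factors of index in the image of [emb] are the variable ones, one for
    each coordinate; the others are constants, which come out of the
    integral. *)
Lemma has_Cintegral_prod_partial (I : finType) n (emb : 'I_n -> I)
    (F : n.-tuple R -> I -> R[i]) (f : 'I_n -> R -> R[i]) (z : I -> R[i]) :
  injective emb ->
  (forall t a, F t (emb a) = f a (tnth t a)) ->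
  (forall a, has_Cintegral leb (f a) (z (emb a))) ->
  (forall t k, k \notin codom emb -> F t k = z k) ->
  has_Cintegral (leb_tuple n) (fun t => \prod_k F t k) (\prod_k z k).
Proof.
move=> emb_inj Femb fz Fz.
have prodE (G : I -> R[i]) : \prod_k G k =
    (\prod_(k | k \notin codom emb) G k) * \prod_a G (emb a).
  rewrite (bigID (mem (codom emb)))/= mulrC; congr (_ * _).
  have ucodom : uniq (codom emb) by rewrite map_inj_uniq ?enum_uniq.
  by rewrite -(big_uniq _ ucodom) big_image.
rewrite prodE (_ : (fun t => _) = fun t =>
    (\prod_(k | k \notin codom emb) z k) * \prod_a f a (tnth t a)).
  by apply: has_CintegralZ; exact: has_Cintegral_prod.
apply/funext => t; rewrite prodE; congr (_ * _).
  by apply: eq_bigr => k; exact: Fz.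
by apply: eq_bigr => a _; exact: Femb.
Qed.

(** A pseudo-determinant is a linear combination of products over the slices, so
    only these products have to be integrated. *)
Lemma has_Cintegral_pseudo_det d (T : measurableType d)
    (mu : {measure set T -> \bar R}) N
    (A : T -> 'I_N -> 'I_N -> 'I_N -> R[i]) (z : 'I_N -> 'I_N -> 'I_N -> R[i]) :
  (forall i j : 'I_N -> 'I_N, has_Cintegral mu
    (fun t => \prod_(k < N) A t (i k) (j k) k) (\prod_(k < N) z (i k) (j k) k)) ->
  has_Cintegral mu (fun t => pseudo_det (A t)) (pseudo_det z).
Proof.
move=> Az; apply: has_Cintegral_sum => s; apply: has_CintegralZ.
by apply: has_Cintegral_sum => r; exact: (has_CintegralZ _ (Az s r)).
Qed.

Lemma has_Cintegral_indic (D : set R) (f : R -> R[i]) :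
  measurable D -> Cintegrable D f ->
  has_Cintegral leb (fun y => \1_D y * f y) (Cintegral D f).
Proof.
move=> mD [intRe intIm].
have patch (g : R -> R) : leb.-integrable D (EFin \o g) ->
    has_integral leb (g \_ D) (\int[leb]_(x in D) g x).
  move=> intg; split.
    by have := (@integrable_mkcond _ _ _ leb D _ mD).1 intg; rewrite restrict_EFin.
  rewrite /Rintegral fineK; last exact: integrable_fin_num.
  by rewrite [RHS]integral_mkcond restrict_EFin.
split => /=.
  rewrite (_ : (fun y => _) = (fun y => complex.Re (f y)) \_ D).
    exact: patch.
  apply/funext => y; rewrite patchE indicE.
  by case: (y \in D); case: (f y) => a b /=; rewrite ?mul0r ?subr0 ?mul1r.
rewrite (_ : (fun y => _) = (fun y => complex.Im (f y)) \_ D).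
  exact: patch.
apply/funext => y; rewrite patchE indicE.
by case: (y \in D); case: (f y) => a b /=; rewrite ?mul0r ?addr0 ?mul1r.
Qed.

End has_integral.

(** * Relaxing the order around one coordinate *)

Section intervals.
Context {R : realType} (al be : \bar R).

Lemma measurable_segment : measurable (segment al be).
Proof.
rewrite (_ : segment al be = (EFin @^-1` `[al, be]%classic)).
  rewrite -[X in measurable X]setTI; apply: EFin_measurable => //.
  exact: emeasurable_itv.
by apply/seteqP; split=> x; rewrite /segment /= in_itv.
Qed.

End intervals.

Section pivot.
Context {R : realType} (al be : \bar R).

Lemma measurable_above (x : R) : measurable (above be x).
Proof.
rewrite (_ : above be x = segment x%:E be); first exact: measurable_segment.
by apply/seteqP; split=> y; rewrite /segment /above /= lee_fin => /andP.
Qed.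

Lemma measurable_below (x : R) : measurable (below al x).
Proof.
rewrite (_ : below al x = segment al x%:E); first exact: measurable_segment.
by apply/seteqP; split=> y; rewrite /segment /below /= lee_fin => /andP.
Qed.

Section fixed_dimension.
Context (M : nat).
Implicit Types (s : 'S_M) (t : M.-tuple R) (l : 'I_M).

Lemma measurable_ordered_region : measurable (@ordered_region R al be M).
Proof.
rewrite (_ : ordered_region al be =
    box (fun=> segment al be) `&` decreasing_on [set: 'I_M]).
  apply: measurableI; last exact: measurable_decreasing_on.
  by apply: measurable_box => _; exact: measurable_segment.
apply/seteqP; split=> t [seg dec]; split => // i j.
  by move=> _ _; exact: dec.
by apply: dec; rewrite finset.inE.
Qed.

(** This carries facts known on the ordered region over to symmetric functions
    on the whole cube. *)
Lemma permute_into_ordered_region t : box (fun=> segment al be) t ->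
  exists s, ordered_region al be (permute_tuple s t).
Proof.
move=> seg; have [s _ dec] := exists_sorting [set: 'I_M] t; exists s; split.
  by move=> i; rewrite tnth_mktuple; exact: seg.
by move=> i j; apply: dec; rewrite finset.inE.
Qed.

(** The ordered region without the order constraints inside the two blocks of
    coordinates before and after [l]; for a fixed value of the [l]-th coordinate
    it is a product of intervals. *)
Definition pivot_region l : set (M.-tuple R) :=
  [set t | segment al be (tnth t l) /\
    forall k : 'I_M, ((k < l)%N -> above be (tnth t l) (tnth t k)) /\
                     ((l < k)%N -> below al (tnth t l) (tnth t k))].

Definition before l : {set 'I_M} := [set k : 'I_M | (k < l)%N]%SET.
Definition after l : {set 'I_M} := [set k : 'I_M | (l < k)%N]%SET.

Lemma card_before l : #|before l| = l.
Proof.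
rewrite -sum1_card (eq_bigl (fun k : 'I_M => k < l)%N) => [|k]; last first.
  by rewrite finset.inE.
by rewrite (big_ord_narrow (ltnW (ltn_ord l))) sum1_card card_ord.
Qed.

Lemma card_after l : #|after l| = (M - l.+1)%N.
Proof.
have -> : after l = ~: (l |: before l).
  by apply/setP => k; rewrite !finset.inE negb_or -leqNgt ltn_neqAle eq_sym.
rewrite cardsCs finset.setCK cardsU1 card_before card_ord.
by rewrite finset.inE ltnn.
Qed.

Lemma pivot_region_permute l s t : perm_on (before l) s \/ perm_on (after l) s ->
  pivot_region l (permute_tuple s t) = pivot_region l t.
Proof.
move=> sA.
have [sl [s_lt s_gt]] : s l = l /\
    ((forall k, (s k < l)%N = (k < l)%N) /\ (forall k, (l < s k)%N = (l < k)%N)).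
  case: sA => sA.
    have sl : s l = l by rewrite (out_perm sA)// finset.inE ltnn.
    have s_lt k : (s k < l)%N = (k < l)%N.
      by have := perm_closed k sA; rewrite !finset.inE.
    split=> //; split=> // k; rewrite !ltn_neqAle leqNgt s_lt -leqNgt; congr (_ && _).
    by rewrite -{1}sl !(inj_eq val_inj) (inj_eq perm_inj).
  have sl : s l = l by rewrite (out_perm sA)// finset.inE ltnn.
  have s_gt k : (l < s k)%N = (l < k)%N.
    by have := perm_closed k sA; rewrite !finset.inE.
  split=> //; split=> // k; rewrite !ltn_neqAle leqNgt s_gt -leqNgt; congr (_ && _).
  by rewrite -{1}sl !(inj_eq val_inj) (inj_eq perm_inj).
rewrite /pivot_region /= tnth_mktuple sl; apply/propext; split=> -[seg pivot].
  split=> // k; have := pivot (s^-1%g k).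
  by rewrite tnth_mktuple permKV -s_lt -s_gt permKV.
by split=> // k; have := pivot (s k); rewrite tnth_mktuple s_lt s_gt.
Qed.

Lemma sub_pivot_region l : pivot_region l `<=` box (fun=> segment al be).
Proof.
move=> t [seg_l pivot] k.
rewrite /segment /=; case: (ltngtP k l) => [kl|lk|/val_inj->//].
  have [lk ->] := (pivot k).1 kl; rewrite andbT.
  by case/andP: seg_l => /le_trans al_l _; apply: al_l; rewrite lee_fin.
have [->/= kl] := (pivot k).2 lk.
by case/andP: seg_l => _; apply: le_trans; rewrite lee_fin.
Qed.

Lemma ordered_regionE l :
  @ordered_region R al be M = pivot_region l `&`
    decreasing_on (before l) `&` decreasing_on (after l).
Proof.
apply/seteqP; split=> [t [seg dec]|t [[[seg_l pivot] dec_b] dec_a]].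
  split; [split; [split=> // k; split=> kl; split|]|] => [||||i j _ _|i j _ _].
  - by apply: dec; exact: ltnW.
  - by case/andP: (seg k).
  - by case/andP: (seg k).
  - by apply: dec; exact: ltnW.
  - exact: dec.
  - exact: dec.
split=> [|i j]; first by apply: (@sub_pivot_region l).
case: (ltngtP i l) => [il|li|/val_inj->]; case: (ltngtP j l) => [jl|lj|/val_inj->].
- by apply: dec_b; rewrite finset.inE.
- by move=> _; exact: le_trans ((pivot j).2 lj).2 ((pivot i).1 il).1.
- by move=> _; exact: ((pivot i).1 il).1.
- by move=> ij; have := leq_ltn_trans ij jl; rewrite ltnNge (ltnW li).
- by apply: dec_a; rewrite finset.inE.
- by rewrite leqNgt li.
- by [].
- by move=> _; exact: ((pivot j).2 lj).2.
- by [].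
Qed.

Lemma measurable_pivot_region l : measurable (pivot_region l).
Proof.
pose D (k : 'I_M) : set (M.-tuple R) :=
  if (k < l)%N then [set t | tnth t l <= tnth t k]
  else [set t | tnth t k <= tnth t l].
have -> : pivot_region l = box (fun=> segment al be) `&` \bigcap_k D k.
  apply/seteqP; split=> [t tP|t [seg tD]].
    split; first exact: sub_pivot_region tP.
    move=> k _; case: tP => seg_l pivot; rewrite /D.
    by case: (ltngtP k l) => [/(pivot k).1[]|/(pivot k).2[]|/val_inj->/=].
  split; first exact: seg.
  move=> k; have := tD k Logic.I; rewrite /D; case/andP: (seg k).
  by case: ltngtP => // *; split.
apply: measurableI.
  by apply: measurable_box => _; exact: measurable_segment.
apply: fin_bigcap_measurable => // k _; rewrite /D.
by case: ifP => _; rewrite -[X in measurable X]setTI;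
  apply: measurable_fun_le => //; exact: measurable_tnth.
Qed.

(** Restoring the order inside each of the two blocks costs the factorial of its
    length.  The blocks are sorted one after the other: being sorted before [l]
    is not affected by permutations of the coordinates after [l]. *)
Lemma integral_pivot_region l (h : M.-tuple R -> \bar R) (S : set R) :
  measurable S -> measurable_fun (pivot_region l) h ->
  (forall t, pivot_region l t -> 0 <= h t)%E ->
  (forall s t, h (permute_tuple s t) = h t) ->
  (\int[lebesgue_measure_tuple R M]_(t in
     pivot_region l `&` [set t | S (tnth t l)]) h t =
   (l`! * (M - l.+1)`!)%:R%:E *
   \int[lebesgue_measure_tuple R M]_(t in
     ordered_region al be `&` [set t | S (tnth t l)]) h t)%E.
Proof.
move=> mS mh h0 hsym.
pose Sl : set (M.-tuple R) := [set t | S (tnth t l)].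
have mSl : measurable Sl.
  by rewrite -[X in measurable X]setTI; exact: measurable_tnth.
have mP := measurable_pivot_region l.
pose g := h \_ (pivot_region l `&` Sl).
have mg : measurable_fun setT g.
  apply/(measurable_restrictT _ (measurableI _ _ mP mSl)).
  exact: measurable_funS mP (@subIsetl _ _ _) mh.
have g0 t : (0 <= g t)%E.
  by rewrite /g patchE; case: ifPn => // /set_mem[/h0].
have gsym s t : perm_on (before l) s \/ perm_on (after l) s ->
    g (permute_tuple s t) = g t.
  move=> sA; rewrite /g !patchE hsym; congr (if _ then _ else _).
  have sl : s l = l by case: sA => sA; rewrite (out_perm sA)// finset.inE ltnn.
  have E : (pivot_region l `&` Sl) (permute_tuple s t) = (pivot_region l `&` Sl) t.
    by rewrite /setI /= pivot_region_permute// /Sl /= tnth_mktuple sl.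
  by apply/idP/idP => /set_mem Pt; apply/mem_set; move: Pt; rewrite E.
have mdec A := @measurable_decreasing_on R M A.
rewrite [LHS]integral_mkcond -/Sl -/g.
rewrite (integral_symmetrize mg g0 (fun s t sA => gsym s t (or_introl sA))).
rewrite (@integral_symmetrize _ _ (after l)); last 3 first.
- by apply: emeasurable_funM => //; apply/measurable_EFinP.
- by move=> t; rewrite mule_ge0// lee_fin.
- move=> s t sA; rewrite gsym; last by right.
  congr (_ * _%:E)%E; rewrite !indicE; congr (_%:R).
  have sb k : k \in before l -> s k = k.
    by rewrite finset.inE => kl; rewrite (out_perm sA)// finset.inE -leqNgt ltnW.
  have E i j : i \in before l -> j \in before l ->
      (tnth (permute_tuple s t) j <= tnth (permute_tuple s t) i) =
      (tnth t j <= tnth t i).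
    by move=> ib jb; rewrite !tnth_mktuple !sb.
  congr (nat_of_bool _); apply/idP/idP => /set_mem dec; apply/mem_set => i j ib jb ij.
    by rewrite -E//; exact: dec.
  by rewrite E//; exact: dec.
rewrite card_before card_after muleA -EFinM -natrM; congr (_ * _)%E.
rewrite [RHS]integral_mkcond; apply: eq_integral => t _.
rewrite /g /Sl !patchE (ordered_regionE l) !indicE -[point]/(0 : \bar R)%E.
move: (pivot_region l) [set u | S (tnth u l)] => P Q.
move: (decreasing_on (before l)) (decreasing_on (after l)) => D1 D2.
rewrite !in_setI.
by case: (t \in P); case: (t \in Q); case: (t \in D1); case: (t \in D2);
  rewrite /= ?mul0e ?mule1 ?mule0.
Qed.

(** The cube is the union of the finitely many images of the ordered region
    under permutations of the coordinates. *)
Lemma measurable_fun_symmetric (f : M.-tuple R -> R) :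
  measurable_fun (ordered_region al be) f ->
  (forall s t, f (permute_tuple s t) = f t) ->
  measurable_fun (box (fun=> segment al be)) f.
Proof.
move=> mf fsym.
have mo := measurable_ordered_region.
have mperm s : measurable (permute_tuple s @^-1` ordered_region al be).
  by rewrite -[X in measurable X]setTI; exact: measurable_permute_tuple.
have -> : box (fun=> segment al be) =
    \big[setU/set0]_(s : 'S_M) (permute_tuple s @^-1` ordered_region al be).
  rewrite -bigcup_seq; apply/seteqP; split=> [t seg|t [s _ [seg _]] i].
    have [s ts] := permute_into_ordered_region seg.
    by exists s; rewrite //= mem_index_enum.
  by have := seg (s^-1%g i); rewrite tnth_mktuple permKV.
(* Measurability of the domain is needed to glue, hence the conjunction. *)
suff: forall D, D = \big[setU/set0]_(s : 'S_M)
      (permute_tuple s @^-1` ordered_region al be) ->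
    measurable D /\ measurable_fun D f by move=> /(_ _ erefl)[].
move=> _ ->; elim/big_ind : _ => [|A B [mA fA] [mB fB]|s _].
- by split=> //; exact: measurable_fun_set0.
- by split; [exact: measurableU|exact/measurable_funU].
- split=> //; rewrite (_ : f = f \o permute_tuple s); last first.
    by apply/funext => t; rewrite /= fsym.
  apply: (measurable_comp mo) => //; first by move=> _ [t st <-].
  by apply: measurable_funTS; exact: measurable_permute_tuple.
Qed.

End fixed_dimension.
End pivot.

(** * Integrating out all coordinates but one *)

Section slice.
Context {R : realType} (m N : nat) (hMN : (m.+1 <= N)%N).
Context (al be : \bar R).
Context (Phi : 'I_m.+1 -> R -> R[i]) (Psi : 'I_N -> R -> R[i]).
Context (Psibar : 'I_N -> 'I_N -> R[i]) (xi : R -> R[i]) (K : R[i]).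
Context (l : 'I_m.+1).
Context (hint : marginal_tensor_integrable al be Phi Psi xi l).

Notation leb := (@lebesgue_measure R).
Notation leb_tuple := (lebesgue_measure_tuple R).
Notation jd := (joint_density Phi Psi Psibar xi K).
Notation pt := (point_tensor Phi Psi Psibar xi).

(** The [l]-th coordinate is inserted by permuting a tuple that has it as its
    head, so that Tonelli's theorem for the head applies. *)
Definition insert_tuple (x : R) (u : m.-tuple R) : m.+1.-tuple R :=
  permute_tuple (lift_perm l ord0 1) (tuple_cons (x, u)).

Lemma tnth_insert_tuple x u : tnth (insert_tuple x u) l = x.
Proof. by rewrite tnth_mktuple lift_perm_id tnth0. Qed.

Lemma tnth_insert_tuple_lift x u a :
  tnth (insert_tuple x u) (lift l a) = tnth u a.
Proof.
by rewrite tnth_mktuple lift_perm_lift perm1 tnthS; congr tnth; exact: val_inj.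
Qed.

Definition slice (x : R) (k : 'I_m.+1) : set R :=
  if (k < l)%N then above be x else if (l < k)%N then below al x else setT.

(** The indicator of the pivot region as a product over the slices of the
    tensor, with weight [1] on the constant slices, so that it can be absorbed
    into the tensor. *)
Definition slice_weight (t : m.+1.-tuple R) (k : 'I_N) : R[i] :=
  if insub (val k) is Some k' then \1_(slice (tnth t l) k') (tnth t k') else 1.

Lemma prod_slice_weight t : segment al be (tnth t l) ->
  \prod_k slice_weight t k = (t \in pivot_region al be l)%:R.
Proof.
move=> seg_l; have [tP|tP] := boolP (t \in pivot_region al be l).
  apply: big1 => k _; rewrite /slice_weight; case: insubP => // k' _ _.
  rewrite indicE mem_set// /slice; case/set_mem: tP => _ /(_ k')[Pa Pb].
  by case: (ltngtP k' l).
have /existsNP[k' tk'] : ~ forall k, slice (tnth t l) k (tnth t k).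
  move=> tslice; move/negP: tP; apply; apply/mem_set; split=> // k.
  by have := tslice k; rewrite /slice; case: ltngtP => // ? ?; split.
rewrite (bigD1 (widen_ord hMN k'))//= /slice_weight /= valK indicE memNset//.
by rewrite mul0r.
Qed.

(** The weighted point tensor has constant slices at [l] and beyond [M], and each
    other slice depends on one coordinate of [u]; integrating it over that
    coordinate gives the slice of the marginal tensor. *)
Lemma has_Cintegral_slice x : segment al be x ->
  has_Cintegral (leb_tuple m)
    (fun u => if insert_tuple x u \in pivot_region al be l
              then jd (insert_tuple x u) else 0)
    (K * pseudo_det (marginal_tensor al be Phi Psi Psibar xi l x)).
Proof.
move=> seg_x.
rewrite (_ : (fun u => _) = fun u => K * pseudo_det (fun i j k =>
    slice_weight (insert_tuple x u) k * pt (insert_tuple x u) i j k)); last first.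
  apply/funext => u; rewrite pseudo_det_scale prod_slice_weight ?tnth_insert_tuple//.
  rewrite joint_densityE//.
  by case: ifP => _; rewrite ?mul1r ?mul0r ?mulr0.
apply: has_CintegralZ; apply: has_Cintegral_pseudo_det => i j.
pose emb (a : 'I_m) := widen_ord hMN (lift l a).
pose f (a : 'I_m) (y : R) := \1_(slice x (lift l a)) y *
  (varsigma Phi xi (i (emb a)) y * Psi (j (emb a)) y).
apply: (@has_Cintegral_prod_partial _ _ _ emb _ f
  (fun k => marginal_tensor al be Phi Psi Psibar xi l x (i k) (j k) k)).
- by move=> a b /(congr1 val) ab; apply: (@lift_inj _ l); apply: val_inj.
- move=> u a; rewrite /slice_weight /point_tensor.
  have -> : insub (val (emb a)) = Some (lift l a) by exact: valK.
  by rewrite tnth_insert_tuple tnth_insert_tuple_lift.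
- move=> a; have := hint seg_x (i (emb a)) (j (emb a)) (emb a).
  have : lift l a != l by rewrite eq_sym neq_lift.
  rewrite /f /slice /marginal_tensor /emb; move: (lift l a) => k' k'l /=.
  rewrite (ltn_ord k') andbT; move: k'l; rewrite -(inj_eq val_inj) /=.
  case: ltngtP => // _ _ [intA intB].
    by apply: has_Cintegral_indic; [exact: measurable_above|exact: intA].
  by apply: has_Cintegral_indic; [exact: measurable_below|exact: intB].
- move=> u k kN; rewrite /slice_weight /point_tensor /marginal_tensor.
  case: insubP => [k' _ k'k|kM].
    have k'l : k' = l.
      apply/eqP/negPn/negP => k'l; move/negP: kN; apply.
      case: (unliftP l k') k'l => [a k'a _|->]; last by rewrite eqxx.
      by apply/codomP; exists a; apply: val_inj; rewrite /= -k'k k'a.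
    have kl : val k = val l by rewrite -k'k k'l.
    have -> : (k < l)%N = false by rewrite [nat_of_ord k]kl ltnn.
    by rewrite kl eqxx k'l tnth_insert_tuple /slice !ltnn indicE mem_set// mul1r.
  have lk : (l < k)%N by apply: leq_trans (ltn_ord l) _; rewrite leqNgt.
  have -> : (k < l)%N = false by rewrite ltnNge (ltnW lk).
  have -> : (k < m.+1)%N = false by exact: negbTE.
  have -> : (val k == val l) = false by rewrite gtn_eqF.
  exact: mul1r.
Qed.

End slice.

Lemma Re_realM (R : realType) (r : R) (z : R[i]) :
  complex.Re (r%:C * z) = r * complex.Re z.
Proof. by case: z => a b /=; rewrite mul0r subr0. Qed.

Theorem lemma3p1 (R : realType) (d : measure_display) (Omega : measurableType d)
    (P : probability Omega R) (M N : nat) (hM : (1 <= M)%N) (hMN : (M <= N)%N)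
    (al be : \bar R) (hab : (al < be)%E)
    (Phi : 'I_M -> R -> R[i]) (Psi : 'I_N -> R -> R[i])
    (Psibar : 'I_N -> 'I_N -> R[i]) (xi : R -> R[i]) (K : R[i])
    (lambda : 'I_M -> {RV P >-> R})
    (hord : {ae P, forall w,
       ordered_region al be [tuple lambda i w | i < M]})
    (hpdf : is_pdf_on (lebesgue_measure_tuple R M) (ordered_region al be)
       (joint_density Phi Psi Psibar xi K)
       (pushforward P (fun w => [tuple lambda i w | i < M])))
    (l : 'I_M)
    (hint : marginal_tensor_integrable al be Phi Psi xi l) :
  is_pdf_on (@lebesgue_measure R) (segment al be)
    (fun x => marginal_const l * K *
       pseudo_det (marginal_tensor al be Phi Psi Psibar xi l x))
    (distribution P (lambda l)).
Proof.
case: hpdf => mf f0 nuE.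
case: M => [//|m] in hM hMN Phi lambda hord mf f0 nuE l hint *.
pose pd x := K * pseudo_det (marginal_tensor al be Phi Psi Psibar xi l x).
pose f := joint_density Phi Psi Psibar xi K.
pose h t := (complex.Re (f t))%:E.
pose c : R := (l`! * (m.+1 - l.+1)`!)%:R.
have c_gt0 : 0 < c by rewrite ltr0n muln_gt0 !fact_gt0.
have fsym s t : f (permute_tuple s t) = f t by exact: joint_density_permute.
have f_ge0 t : pivot_region al be l t -> 0 <= f t.
  by move=> /sub_pivot_region/permute_into_ordered_region[s] /f0; rewrite -/f fsym.
have mh : measurable_fun (pivot_region al be l) h.
  apply/measurable_EFinP; apply: measurable_funS (@sub_pivot_region _ _ _ _ l) _.
    by apply: measurable_box => _; exact: measurable_segment.
  by apply: measurable_fun_symmetric => // s t; rewrite fsym.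
(* Extension by zero makes the integrand total, as Tonelli's theorem asks. *)
pose g (S : set R) := h \_ (pivot_region al be l `&` [set t | S (tnth t l)]).
have mpivot (S : set R) : measurable S ->
    measurable (pivot_region al be l `&` [set t | S (tnth t l)]).
  move=> mS; apply: measurableI; first exact: measurable_pivot_region.
  by rewrite -[X in measurable X]setTI; exact: measurable_tnth.
have mg S : measurable S -> measurable_fun setT (g S).
  move=> mS; apply/(measurable_restrictT _ (mpivot _ mS)).
  by apply: measurable_funS (@subIsetl _ _ _) mh; exact: measurable_pivot_region.
have g0 S t : (0 <= g S t)%E.
  rewrite /g patchE; case: ifPn => // /set_mem[/f_ge0 ft _].
  by move: ft; rewrite lecE lee_fin => /andP[].
have gE x S : (\int[lebesgue_measure_tuple R m]_u g S (insert_tuple l x u))%E =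
    if x \in S `&` segment al be then (complex.Re (pd x))%:E else 0%E.
  case: ifPn => [/set_mem[Sx seg_x]|Sx].
    have [[_ <-] _] := has_Cintegral_slice hMN Psibar K hint seg_x.
    apply: eq_integral => u _; rewrite /g patchE in_setI.
    rewrite [X in _ && X]mem_set /= ?tnth_insert_tuple// andbT.
    by case: ifP.
  apply: integral0_eq => u _; rewrite /g patchE memNset// => -[[seg_x _] Sx'].
  move/negP: Sx; apply; apply/mem_set; split.
    by move: Sx'; rewrite /= tnth_insert_tuple.
  by move: seg_x; rewrite tnth_insert_tuple.
(* On the pivot region the density is real, so the imaginary part integrates
   to zero; this holds at every point and not only almost everywhere. *)
have pd_ge0 x : segment al be x -> 0 <= pd x.
  move=> seg_x; have [[_ ReE] [_ ImE]] := has_Cintegral_slice hMN Psibar K hint seg_x.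
  rewrite lecE; apply/andP; split.
    rewrite -(inj_eq (@EFin_inj R)) -ImE; apply/eqP; apply: integral0_eq => u _.
    by case: ifP => // /set_mem/f_ge0; rewrite lecE => /andP[/eqP->].
  rewrite -lee_fin -ReE; apply: integral_ge0 => u _.
  by case: ifP => // /set_mem/f_ge0; rewrite lecE lee_fin => /andP[].
have mperm := @measurable_permute_tuple R m.+1 (lift_perm l ord0 1).
have slice_int S : measurable S ->
   (\int[lebesgue_measure_tuple R m.+1]_t g S t =
    \int[lebesgue_measure]_x
      \int[lebesgue_measure_tuple R m]_u g S (insert_tuple l x u))%E.
  move=> mS; rewrite -(ge0_integral_permute (lift_perm l ord0 1) (mg S mS) (g0 S)).
  rewrite (@ge0_integral_tuple_cons _ _ (g S \o permute_tuple (lift_perm l ord0 1)))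
    => [//||t]; last exact: g0.
  exact: (measurableT_comp (mg S mS) mperm).
have mpd : measurable_fun (segment al be) (fun x => complex.Re (pd x)).
  apply/measurable_EFinP.
  apply: (@eq_measurable_fun _ _ _ _ _
      (fun x => \int[lebesgue_measure_tuple R m]_u g setT (insert_tuple l x u))%E).
    by move=> x seg_x; rewrite gE setTI seg_x.
  apply: measurable_funTS.
  apply: (@measurable_fun_fubini_tonelli_F _ _ _ _ R (lebesgue_measure_tuple R m)
    (g setT \o permute_tuple (lift_perm l ord0 1) \o @tuple_cons R m))
    => [|p]; last exact: g0.
  apply: measurableT_comp; last exact: measurable_tuple_cons.
  by apply: measurableT_comp => //; exact: mg.
have constE : marginal_const l = (c^-1)%:C :> R[i].
  by rewrite /marginal_const fmorphV rmorph_nat.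
split.
- rewrite (_ : (fun x => _) = fun x => c^-1 * complex.Re (pd x)).
    exact: measurable_funM.
  by apply/funext => x; rewrite -mulrA constE Re_realM.
- move=> x /pd_ge0 pdx; rewrite -mulrA constE mulr_ge0//.
  by rewrite ler0c invr_ge0 ltW.
- move=> S mS.
  pose Sl : set (m.+1.-tuple R) := [set t | S (tnth t l)].
  have mSl : measurable Sl.
    by rewrite -[X in measurable X]setTI; exact: measurable_tnth.
  transitivity (pushforward P (fun w => [tuple lambda i w | i < m.+1]) Sl).
    by congr (P _); apply/seteqP; split=> w; rewrite /Sl /= tnth_mktuple.
  rewrite nuE// setIC.
  have h_ge0 t : pivot_region al be l t -> (0 <= h t)%E.
    by move/f_ge0; rewrite lecE lee_fin => /andP[].
  have h_sym s t : h (permute_tuple s t) = h t by rewrite /h fsym.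
  have pivotE := integral_pivot_region mS mh h_ge0 h_sym.
  have -> : (\int[lebesgue_measure_tuple R m.+1]_(t in ordered_region al be `&` Sl) h t =
      c^-1%:E * \int[lebesgue_measure_tuple R m.+1]_t g S t)%E.
    rewrite -[X in (_ * X)%E]integral_mkcond pivotE muleA -EFinM mulVf ?mul1e//.
    exact: lt0r_neq0.
  rewrite slice_int//.
  transitivity (c^-1%:E * \int[lebesgue_measure]_(x in S `&` segment al be)
      (complex.Re (pd x))%:E)%E.
    congr (_ * _)%E; rewrite [RHS]integral_mkcond.
    by apply: eq_integral => x _; exact: gE.
  rewrite -ge0_integralZl//.
  - by apply: eq_integral => x _; rewrite -mulrA constE Re_realM EFinM.
  - by apply: measurableI => //; exact: measurable_segment.
  - apply/measurable_EFinP; apply: measurable_funS (@subIsetr _ _ _) mpd.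
    exact: measurable_segment.
  - by move=> x [_ /pd_ge0]; rewrite lecE lee_fin => /andP[].
  - by rewrite lee_fin invr_ge0 ltW.
Qed.
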